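(* Let $S$ be a multiplicatively closed subset of a ring $R$ and let $I$ be an ideal of $R$ with $I\cap S=\emptyset$. Then $I$ is an $S$-$1$-absorbing primary ideal of $R$ if and only if there exists $s\in S$ such that for all proper ideals $I_{1},I_{2},I_{3}$ of $R$, if $I_{1}I_{2}I_{3}\subseteq I$, then $sI_{1}I_{2}\subseteq I$ or $sI_{3}\subseteq\sqrt{I}$.
   Context: All rings are commutative with non-zero identity. $\sqrt{I}$ is the radical of the ideal $I$. A proper ideal $I$ of $R$ with $I\cap S=\emptyset$ is called $S$-$1$-absorbing primary if there exists a fixed $s\in S$ such that for all non-unit $a,b,c\in R$, if $abc\in I$, then $sab\in I$ or $sc\in\sqrt{I}$. *)

(* Defs.v *)
From mathcomp Require Import all_boot all_order all_algebra.
From mathcomp Require Import ring_quotient.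
From mathcomp Require Import boolp classical_sets.

Set Implicit Arguments.
Unset Strict Implicit.
Unset Printing Implicit Defensive.

Import GRing.Theory.
Local Open Scope ring_scope.
Local Open Scope classical_set_scope.

(* Subsets of [R] are arbitrary Prop-valued sets; [mem A] views
   [A : set R] as the boolean predicate expected by the algebra library. *)

(* 1 \in S and S is stable under products; 0 \in S is not excluded. *)
Definition mult_closed (R : comNzRingType) (S : set R) : Prop :=
  GRing.mulr_closed (mem S).

(* Ideals, possibly improper: the R-submodules of R. *)
Definition is_ideal (R : comNzRingType) (I : set R) : Prop :=
  GRing.submod_closed (mem I : {pred R^o}).

(* [idealr_closed] already includes 1 \notin I. *)
Definition is_proper_ideal (R : comNzRingType) (I : set R) : Prop :=
  idealr_closed (mem I).

Lemma is_proper_idealE (R : comNzRingType) (I : set R) :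
  is_proper_ideal I <-> is_ideal I /\ I <> setT.
Proof.
split=> [[I0 /negP I1 Il]|[[I0 Il] IT]].
  by split=> // IT; apply: I1; rewrite IT; apply: mem_set.
split=> //; apply/negP => I1; apply: IT; apply/seteqP; split=> // x _.
by apply: set_mem; have := Il x _ _ I1 I0; rewrite addr0 [x *: _]mulr1.
Qed.

(* [R] carries no canonical unit predicate, so invertibility is spelled out. *)
Definition is_unit (R : comNzRingType) (x : R) : Prop :=
  exists y : R, x * y = 1.

Definition radical (R : comNzRingType) (I : set R) : set R :=
  [set x | exists n : nat, (0 < n)%N /\ I (x ^+ n)].

(* The ideal generated by the products of an element of I and one of J. *)
Definition ideal_mul (R : comNzRingType) (I J : set R) : set R :=
  smallest (@is_ideal R) [set x * y | x in I & y in J].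

Definition scale_set (R : comNzRingType) (s : R) (A : set R) : set R :=
  [set s * x | x in A].

Definition S_1_absorbing_primary (R : comNzRingType) (S I : set R) : Prop :=
  [/\ is_proper_ideal I, I `&` S = set0 &
    exists s : R, S s /\
      forall a b c : R, ~ is_unit a -> ~ is_unit b -> ~ is_unit c ->
        I (a * b * c) -> I (s * a * b) \/ radical I (s * c)].

(* Main.v *)
Require Import Defs.
From mathcomp Require Import all_boot all_order all_algebra.
From mathcomp Require Import boolp classical_sets.

(** The same [s] works on both sides.

    From elements to ideals: if [s I3] is not inside the radical, fix a single
    witness [c] in [I3].  Elements of proper ideals are non-units, so the
    elementwise condition applies to every [a] in [I1] and [b] in [I2] with
    this one [c], and its second alternative is excluded; hence [s] carries
    all products [a b] into [I].  Since the elements carried into [I] by [s]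
    form an ideal ([colon_ideal]), this extends from the products to the ideal
    that they generate.

    From ideals to elements: apply the condition to the principal ideals of
    [a], [b] and [c], which are proper because these elements are not units.
    Colon ideals again reduce the inclusion of the triple product in [I] to the
    generators, where it is [a b c] in [I].  Finally [I] is proper because [S]
    contains [1] and misses [I]. *)

Import GRing.Theory.
Local Open Scope ring_scope.
Local Open Scope classical_set_scope.

Lemma is_idealP (R : comNzRingType) (I : set R) :
  is_ideal I <->
  I 0 /\ forall a x y : R, I x -> I y -> I (a * x + y).
Proof.
split=> [[I0 IL]|[I0 IL]]; split.
- exact: set_mem.
- by move=> a x y Ix Iy; apply: set_mem; apply: IL; apply: mem_set.
- exact: mem_set.
- by move=> a x y Ix Iy; apply: mem_set; apply: IL; apply: set_mem.
Qed.

Lemma ideal_mulr (R : comNzRingType) (I : set R) (x a : R) :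
  is_ideal I -> I x -> I (x * a).
Proof.
move=> /is_idealP[I0 IL] Ix.
by rewrite mulrC -[a * x]addr0; apply: IL.
Qed.

Lemma proper_ideal_nonunit (R : comNzRingType) (J : set R) (x : R) :
  is_proper_ideal J -> J x -> ~ is_unit x.
Proof.
move=> Jp Jx [y xy1]; have [Ji _] := (is_proper_idealE J).1 Jp.
case: Jp => _ /negP J1 _; apply: J1; apply: mem_set.
by rewrite -xy1; apply: ideal_mulr.
Qed.

Lemma colon_ideal (R : comNzRingType) (I : set R) (t : R) :
  is_ideal I -> is_ideal [set x | I (t * x)].
Proof.
move=> /is_idealP[I0 IL]; apply/is_idealP; split=> [|a x y Ix Iy] /=.
  by rewrite mulr0.
by rewrite mulrDr mulrCA; apply: IL.
Qed.

Lemma principal_ideal (R : comNzRingType) (a : R) :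
  is_ideal (range ( *%R a)).
Proof.
apply/is_idealP; split; first by exists 0 => //; rewrite mulr0.
move=> r _ _ [x _ <-] [y _ <-]; exists (r * x + y) => //.
by rewrite mulrDr mulrCA.
Qed.

Lemma principal_ideal_proper (R : comNzRingType) (a : R) :
  ~ is_unit a -> is_proper_ideal (range ( *%R a)).
Proof.
move=> aU; apply/is_proper_idealE; split; first exact: principal_ideal.
move=> aT; apply: aU.
have : range ( *%R a) 1 by rewrite aT.
by case=> y _ ay1; exists y.
Qed.

Lemma principal_ideal_gen (R : comNzRingType) (a : R) : range ( *%R a) a.
Proof. by exists 1 => //; rewrite mulr1. Qed.

Lemma ideal_mul_mem (R : comNzRingType) (J K : set R) (x y : R) :
  J x -> K y -> ideal_mul J K (x * y).
Proof. by move=> Jx Ky; apply: sub_gen_smallest; exists x => //; exists y. Qed.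

Lemma ideal_mul_sub (R : comNzRingType) (J K L : set R) :
  is_ideal L -> (forall x y : R, J x -> K y -> L (x * y)) ->
  ideal_mul J K `<=` L.
Proof.
move=> Li JKL; apply: smallest_sub => // _ [x Jx [y Ky <-]].
exact: JKL.
Qed.

(** The elements that [s] carries into [I] form an ideal, and [ideal_mul J K]
    is the smallest ideal containing the products. *)
Lemma scale_ideal_mul_sub (R : comNzRingType) (I J K : set R) (s : R) :
  is_ideal I -> (forall x y : R, J x -> K y -> I (s * x * y)) ->
  scale_set s (ideal_mul J K) `<=` I.
Proof.
move=> Ii JKI _ [z JKz <-].
apply: (@ideal_mul_sub R J K [set x | I (s * x)]) JKz; first exact: colon_ideal.
by move=> x y Jx Ky /=; rewrite mulrA; apply: JKI.
Qed.

(** The triple product is generated by products [x (c r)] with [x] itself in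
    the ideal generated by products, so the test on generators is made twice:
    for [x (c r)], and, with [c] as the scalar, for [x]. *)
Lemma principal_mul3_sub (R : comNzRingType) (I : set R) (a b c : R) :
  is_ideal I -> I (a * b * c) ->
  ideal_mul (ideal_mul (range ( *%R a)) (range ( *%R b))) (range ( *%R c))
    `<=` I.
Proof.
move=> Ii Iabc; apply: ideal_mul_sub => // x _ abx [r _ <-].
rewrite mulrA; apply: ideal_mulr => //; rewrite mulrC.
apply: (@scale_ideal_mul_sub R I (range ( *%R a)) (range ( *%R b)) c) => //;
  last by exists x.
move=> _ _ [u _ <-] [v _ <-].
by rewrite -mulrA mulrACA (mulrA c) (mulrC c); apply: ideal_mulr.
Qed.

Lemma disjoint_mult_closed_proper (R : comNzRingType) (S I : set R) :
  mult_closed S -> is_ideal I -> I `&` S = set0 -> is_proper_ideal I.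
Proof.
move=> [S1 _] Ii IS0; apply/is_proper_idealE; split=> // IT.
have : (I `&` S) 1 by split; [rewrite IT | exact: set_mem].
by rewrite IS0.
Qed.

Theorem theorem2 (R : comNzRingType) (S I : set R)
    (S_mult : mult_closed S) (I_ideal : is_ideal I)
    (I_disj : I `&` S = set0) :
  S_1_absorbing_primary S I <->
  exists s : R, S s /\
    forall I1 I2 I3 : set R,
      is_proper_ideal I1 -> is_proper_ideal I2 -> is_proper_ideal I3 ->
      ideal_mul (ideal_mul I1 I2) I3 `<=` I ->
      scale_set s (ideal_mul I1 I2) `<=` I \/
      scale_set s I3 `<=` radical I.
Proof.
split=> [[_ _ [s [Ss abs]]]|[s [Ss abs]]].
  exists s; split=> // I1 I2 I3 I1p I2p I3p I123.
  have [sI3|/existsNP[c /not_implyP[I3c scN]]] :=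
    pselect (forall c, I3 c -> radical I (s * c)).
    by right=> _ [c I3c <-]; apply: sI3.
  left; apply: scale_ideal_mul_sub => // a b I1a I2b.
  have [||||//|//] := abs a b c.
  - exact: proper_ideal_nonunit I1p I1a.
  - exact: proper_ideal_nonunit I2p I2b.
  - exact: proper_ideal_nonunit I3p I3c.
  - by apply: I123; apply: ideal_mul_mem => //; apply: ideal_mul_mem.
split=> //; first exact: disjoint_mult_closed_proper S_mult I_ideal I_disj.
exists s; split=> // a b c aU bU cU Iabc.
have [||||sab|sc] := abs (range ( *%R a)) (range ( *%R b)) (range ( *%R c)).
- exact: principal_ideal_proper.
- exact: principal_ideal_proper.
- exact: principal_ideal_proper.
- exact: principal_mul3_sub.
- left; apply: sab; exists (a * b); last by rewrite mulrA.
  by apply: ideal_mul_mem; apply: principal_ideal_gen.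
- by right; apply: sc; exists c => //; apply: principal_ideal_gen.
Qed.
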